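(* Let $k$ be an arbitrary field, let $A\in\mathrm{Mat}_{n\times n}(k)$ and let $A=A_1+A_2$ be its core-nilpotent decomposition. Let $N_u(A)$ be the nullspace of $A$. Then there are bijections $$A(GD1)\;\simeq\;\Big[\prod_{i=1}^{\mathrm{rk}(A_2)}N_u(A)\Big]\times\Big[\prod_{i=1}^{\dim N_u(A)}k^{\mathrm{rk}(A)}\Big]\;\simeq\;k^{[\dim N_u(A)]\cdot(\mathrm{rk}(A)+\mathrm{rk}(A_2))}.$$
   Context: The core-nilpotent decomposition of a square matrix $A$ is the unique decomposition $A=A_1+A_2$ with $\mathrm{rk}(A_1)=\mathrm{rk}(A_1^2)$, $A_2$ nilpotent, and $A_1A_2=A_2A_1=0$. The index $m=i(A)$ is the smallest positive integer with $\mathrm{rk}(A^m)=\mathrm{rk}(A^{m+1})$. A $\{1\}$-inverse of $A$ is $A^-\in\mathrm{Mat}_{n\times n}(k)$ with $AA^-A=A$. A G-Drazin inverse of $A$ is $A^{GD}\in\mathrm{Mat}_{n\times n}(k)$ with $AA^{GD}A=A$ and $A^{GD}A^m=A^mA^{GD}$. $A(GD1)$ is the set of GD1 inverses of $A$: matrices $X\in\mathrm{Mat}_{n\times n}(k)$ such that $XAX=X$, $XA=A^{GD}A$ and $AX=AA^-$ for some $\{1\}$-inverse $A^-$ and some G-Drazin inverse $A^{GD}$ of $A$ (equivalently, $X=A^{GD}AA^-$ for such $A^-$, $A^{GD}$). ''Bijection'' means bijection of sets; empty products are singletons. *)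

(* Defs.v *)
From mathcomp Require Import all_boot all_order all_algebra.
From mathcomp Require Import boolp classical_sets.

Set Implicit Arguments.
Unset Strict Implicit.
Unset Printing Implicit Defensive.

Import GRing.Theory.
Local Open Scope ring_scope.

Section Defs.
Variables (k : fieldType) (n : nat).
Implicit Types A X G : 'M[k]_n.

Definition core_nilpotent_decomposition A A1 A2 : Prop :=
  [/\ A = A1 + A2, \rank A1 = \rank (A1 ^+ 2), exists p : nat, A2 ^+ p = 0,
      A1 *m A2 = 0 & A2 *m A1 = 0].

Lemma ex_mxindex A :
  exists m, (0 < m)%N && (\rank (A ^+ m) == \rank (A ^+ m.+1)).
Proof.
apply: contrapT => noidx.
have rank_drop j : (\rank (A ^+ j.+1) + j <= n)%N.
  elim: j => [|j IHj]; first by rewrite addn0 rank_leq_row.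
  suff : (\rank (A ^+ j.+2) < \rank (A ^+ j.+1))%N.
    by move=> lt_rk; apply: leq_trans IHj; rewrite addnS -addSn leq_add2r.
  rewrite ltn_neqAle [in X in _ && X]exprS mxrankM_maxr andbT eq_sym.
  by apply/negP => eq_rk; apply: noidx; exists j.+1.
by have := leq_trans (leq_addl _ _) (rank_drop n.+1); rewrite ltnn.
Qed.

Definition mxindex A : nat := ex_minn (ex_mxindex A).

Definition inner_inverse A X : Prop := A *m X *m A = A.

Definition GDrazin_inverse A G : Prop :=
  A *m G *m A = A /\ G *m A ^+ mxindex A = A ^+ mxindex A *m G.

Definition GD1_inverse A X : Prop :=
  exists Am G : 'M[k]_n,
    [/\ inner_inverse A Am, GDrazin_inverse A G, X *m A *m X = X,
        X *m A = G *m A & A *m X = A *m Am].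

Definition GD1_inverses A : set 'M[k]_n := [set X | GD1_inverse A X]%classic.

(* A acts on column vectors, whereas [kermx A] is the kernel of the action on
   row vectors. *)
Definition nullspace A : {vspace 'cV[k]_n} :=
  lker (linfun (mulmx A : 'cV[k]_n -> 'cV[k]_n)).

Lemma mem_nullspace A (v : 'cV[k]_n) : (v \in nullspace A) = (A *m v == 0).
Proof. by rewrite memv_ker lfunE. Qed.

End Defs.

(* Main.v *)
(* Write m for the index of A, r for its rank and d for its nullity. The GD1
   inverses of A are exactly the reflexive generalized inverses X of A with
   X A^(m+1) = A^m. Through a full rank factorization A = B C they become the
   products C' B', where B' is any left inverse of B and C' any right inverse of
   C with C' (C A^m) = A^m. These two affine conditions are independent: B'
   varies in a translate of the r x d matrices, and C' in a translate of the
   matrices whose r columns lie in the nullspace of A and which vanish on the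
   range of C A^m. This range has dimension rk(A^m) = rk(A_1), and
   rk(A) = rk(A_1) + rk(A_2), which leaves rk(A_2) free columns in the
   nullspace. *)
Require Import Defs.
From mathcomp Require Import all_boot all_order all_algebra.
From mathcomp Require Import boolp classical_sets.

Set Implicit Arguments.
Unset Strict Implicit.
Unset Printing Implicit Defensive.

Import GRing.Theory VectorInternalTheory.
Local Open Scope ring_scope.

Lemma set_type_bijection (T U : Type) (S : set T) (f : T -> U) (g : U -> T) :
    (forall u, S (g u)) -> (forall x, S x -> g (f x) = x) -> cancel g f ->
  exists h : set_type S -> U, bijective h.
Proof.
move=> Sg fK gK; exists (fun x => f (sval x)).
exists (fun u => exist _ (g u) (mem_set (Sg u)) : set_type S).
  by move=> [x Sx]; apply: val_inj; apply: fK; apply: set_mem.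
by move=> u; apply: gK.
Qed.

(** * Coordinates on kernels, and factorizations forced by ranks *)

Section LinearAlgebra.
Variable k : fieldType.

(** The rows of [L] are a basis of the left kernel of [D], and [L'] reads off coordinates in it.
    Keeping [e] a variable lets it become [\rank A2] without casts. *)
Lemma left_kernel_coordinates m c e (D : 'M[k]_(m, c)) : e = (m - \rank D)%N ->
  exists (L : 'M[k]_(e, m)) (L' : 'M[k]_(m, e)),
    [/\ L *m D = 0, L *m L' = 1%:M
      & forall q (N : 'M[k]_(q, m)), N *m D = 0 -> N *m L' *m L = N].
Proof.
move=> ->; rewrite -mxrank_ker.
have [L' LK] : exists L', row_base (kermx D) *m L' = 1%:M.
  by apply/row_freeP; apply: row_base_free.
exists (row_base (kermx D)), L'; split=> //.
  by apply/sub_kermxP; rewrite eq_row_base.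
move=> q N /sub_kermxP; rewrite -(eq_row_base (kermx D)) => /submxP[Y ->].
by rewrite -(mulmxA Y) LK mulmx1.
Qed.

Lemma right_kernel_coordinates c n d (P : 'M[k]_(c, n)) :
    d = (n - \rank P)%N ->
  exists (K : 'M[k]_(n, d)) (K' : 'M[k]_(d, n)),
    [/\ P *m K = 0, K' *m K = 1%:M
      & forall q (N : 'M[k]_(n, q)), P *m N = 0 -> K *m (K' *m N) = N].
Proof.
rewrite -mxrank_tr => /left_kernel_coordinates[L [L' [LP LL' LK]]].
exists L^T, L'^T; split.
- by apply: trmx_inj; rewrite trmx_mul trmxK trmx0.
- by apply: trmx_inj; rewrite trmx_mul !trmxK trmx1.
move=> q N PN; apply: trmx_inj; rewrite !trmx_mul !trmxK LK //.
by rewrite -trmx_mul PN trmx0.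
Qed.

Lemma dim_nullspace n (A : 'M[k]_n) : \dim (nullspace A) = (n - \rank A)%N.
Proof.
have [K [K' [AK KK' KK]]] := right_kernel_coordinates (erefl (n - \rank A)%N).
pose f : 'Hom('cV[k]_(n - \rank A), 'cV[k]_n) := linfun (mulmx K).
have fE v : f v = K *m v by rewrite lfunE.
have kerf : (fullv :&: lker f = 0)%VS.
  apply/eqP; rewrite capfv; apply/lker0P => u v; rewrite !fE => eq_uv.
  by rewrite -[u]mul1mx -KK' -mulmxA eq_uv mulmxA KK' mul1mx.
have <- : (limg f = nullspace A)%VS.
  apply/vspaceP => v; rewrite mem_nullspace.
  apply/memv_imgP/eqP => [[u _ ->] | Av]; first by rewrite fE mulmxA AK mul0mx.
  by exists (K' *m v); rewrite ?memvf // fE KK.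
by rewrite (limg_dim_eq kerf) dimvf /dim /= muln1.
Qed.

Lemma submx_mull_eq_rank m n p (A : 'M[k]_(m, n)) (B : 'M[k]_(n, p)) :
  \rank (A *m B) = \rank B -> (B <= A *m B)%MS.
Proof.
by move=> eq_rk; have [_ <-] := mxrank_leqif_sup (submxMl A B); apply/eqP.
Qed.

Lemma factor_mulr_eq_rank m n p (A : 'M[k]_(m, n)) (B : 'M[k]_(n, p)) :
  \rank (A *m B) = \rank A -> exists W, A = A *m B *m W.
Proof.
rewrite -mxrank_tr trmx_mul -[in RHS]mxrank_tr => /submx_mull_eq_rank/submxP[W].
by move/(congr1 trmx); rewrite !trmx_mul !trmxK => AW; exists W^T.
Qed.

(** All mixed products vanish. The exponent is a successor because at 0 the right side would be 1 +
    1. *)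
Lemma expr_addr_orthogonal (R : pzRingType) (a b : R) j :
  a * b = 0 -> b * a = 0 -> (a + b) ^+ j.+1 = a ^+ j.+1 + b ^+ j.+1.
Proof.
move=> ab ba; elim: j => [|j IHj]; first by rewrite !expr1.
have abX : a * b ^+ j.+1 = 0 by rewrite exprS mulrA ab mul0r.
have baX : b * a ^+ j.+1 = 0 by rewrite exprS mulrA ba mul0r.
by rewrite exprS IHj mulrDl !mulrDr abX baX addr0 add0r -!exprS.
Qed.

(** * Powers, the index and the GD1 inverses *)

Section Powers.
Variable n : nat.
Implicit Types A X : 'M[k]_n.

Lemma mxindex_gt0 A : (0 < mxindex A)%N.
Proof. by rewrite /mxindex; case: ex_minnP => m /andP[]. Qed.

Lemma rank_mxindexS A : \rank (A ^+ (mxindex A).+1) = \rank (A ^+ mxindex A).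
Proof. by rewrite /mxindex; case: ex_minnP => m /andP[_ /eqP]. Qed.

(** Equal ranks give A^m = V A^(m+1); multiplied by A^j on the right, this makes each later power a
    left multiple of the next, so the rank cannot drop. *)
Lemma rank_exp_stable A m j :
  \rank (A ^+ m.+1) = \rank (A ^+ m) -> \rank (A ^+ (m + j)) = \rank (A ^+ m).
Proof.
move=> eq_rk; have [V AV] : exists V, A ^+ m = V *m A ^+ m.+1.
  apply/submxP; rewrite exprS; have := @submx_mull_eq_rank _ _ _ A (A ^+ m).
  by rewrite -[_ *m _]/(A * A ^+ m) -exprS; apply.
elim: j => [|j IHj]; first by rewrite addn0.
rewrite -{}IHj addnS; apply/eqP; rewrite eqn_leq; apply/andP; split.
  by rewrite exprS mxrankM_maxr.
have -> : A ^+ (m + j) = V *m A ^+ (m + j).+1.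
  by rewrite -addSn !exprD {1}AV [RHS]mulmxA.
by rewrite mxrankM_maxr.
Qed.

Lemma rank_core_nilpotent A A1 A2 : core_nilpotent_decomposition A A1 A2 ->
  \rank A1 = \rank (A ^+ mxindex A) /\ \rank A = (\rank A1 + \rank A2)%N.
Proof.
move=> [-> rkA1 [p A2p] A12 A21]; set B := A1 + A2.
have rkA1X j : \rank (A1 ^+ j.+1) = \rank A1.
  by rewrite -add1n (@rank_exp_stable A1 1) ?expr1.
split.
  (* Passing to the exponent m + p kills the nilpotent part and keeps the rank; m > 0 makes the
     exponent a successor. *)
  rewrite -(rank_exp_stable p (rank_mxindexS B)) -(prednK (mxindex_gt0 B)) addSn.
  by rewrite expr_addr_orthogonal // -addSn [A2 ^+ _]exprD A2p mulr0 addr0 rkA1X.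
have [V A1V] : exists V, A1 = V *m (A1 *m A1).
  by apply/submxP; apply: submx_mull_eq_rank.
have [W A1W] : exists W, A1 = A1 *m A1 *m W.
  by apply: factor_mulr_eq_rank.
have sA1B : (A1 <= B)%MS.
  by rewrite A1V -[A1 *m A1]addr0 -A12 -mulmxDr mulmxA submxMl.
have sA2B : (A2 <= B)%MS.
  by rewrite -[A2](addKr A1) addmx_sub // eqmx_opp.
(* A common row u A1 = v A2 equals u A1 A1 W = v A2 A1 W = 0. *)
have dxA : (A1 :&: A2 = 0)%MS.
  apply/eqP; rewrite -submx0; apply/rV_subP => x.
  rewrite sub_capmx => /andP[/submxP[u ->] /submxP[v eq_uv]].
  by rewrite A1W 2!mulmxA eq_uv -(mulmxA v) A21 mulmx0 mul0mx sub0mx.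
have <- : \rank (A1 + A2)%MS = (\rank A1 + \rank A2)%N.
  by rewrite -mxrank_sum_cap dxA mxrank0 addn0.
apply/eqP; rewrite eqn_leq !mxrankS ?addsmx_sub ?sA1B //.
exact: addmx_sub_adds.
Qed.

(* For the converse, A^- := X, and G := X + (W - X)(1 - A X) is a G-Drazin
   inverse with G A = X A, where A^m = A^(m+1) W. *)
Lemma GD1_inverseP A X :
  GD1_inverse A X <->
  [/\ A *m X *m A = A, X *m A *m X = X
    & X *m A ^+ (mxindex A).+1 = A ^+ mxindex A].
Proof.
set m := mxindex A.
have AmS : A ^+ m.+1 = A *m A ^+ m by rewrite exprS.
have AmSr : A ^+ m.+1 = A ^+ m *m A by rewrite exprSr.
have AmP : A ^+ m = A *m A ^+ m.-1.
  by rewrite -[RHS]exprS prednK // mxindex_gt0.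
have AmPr : A ^+ m = A ^+ m.-1 *m A.
  by rewrite -[RHS]exprSr prednK // mxindex_gt0.
split=> [[Am [G [AAmA [AGA GAm] XAX XA AX]]] | [AXA XAX XAm]].
  split=> //; first by rewrite AX.
  (* X A^(m+1) = G A^m A = A^m G A = A^(m-1) A G A = A^m, using m > 0. *)
  rewrite AmS mulmxA XA -mulmxA -AmS AmSr mulmxA GAm -mulmxA.
  by rewrite AmPr -!mulmxA (mulmxA A) AGA.
have [W AW] : exists W, A ^+ m = A ^+ m.+1 *m W.
  rewrite AmSr; apply: factor_mulr_eq_rank.
  by rewrite -AmSr rank_mxindexS.
have XAmE : X *m A ^+ m = A ^+ m *m W by rewrite {1}AW mulmxA XAm.
have EA : (1%:M - A *m X) *m A = 0 by rewrite mulmxBl mul1mx AXA subrr.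
have GA : (X + (W - X) *m (1%:M - A *m X)) *m A = X *m A.
  by rewrite (mulmxDl _ _ A) -mulmxA EA mulmx0 addr0.
exists X, (X + (W - X) *m (1%:M - A *m X)); split=> //.
split; first by rewrite -mulmxA GA mulmxA.
(* Both G A^m and A^m G equal A^m W: the term A^m (W - X) A X vanishes, since A^m W A X = X A^(m+1)
   X = A^m X. *)
have AmX : A ^+ m *m (X *m (A *m X)) = A ^+ m *m X by rewrite (mulmxA X) XAX.
have AmW : A ^+ m *m (W *m (A *m X)) = A ^+ m *m X.
  by rewrite mulmxA -XAmE -mulmxA (mulmxA (A ^+ m)) -AmSr mulmxA XAm.
have AmWX : A ^+ m *m ((W - X) *m (A *m X)) = 0.
  by rewrite mulmxBl mulmxBr AmX AmW subrr.
rewrite -/m {1}AmP mulmxA GA -mulmxA -AmP XAmE mulmxDr (mulmxBr (W - X)) mulmx1.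
by rewrite (mulmxBr _ (W - X)) AmWX subr0 -mulmxDr addrC subrK.
Qed.

(* The factors in X = C' B' are recovered as C' = X B and B' = C X. *)
Lemma GD1_inverses_param A d e :
    d = (n - \rank A)%N -> (e + \rank (A ^+ mxindex A) = \rank A)%N ->
  exists f : set_type (GD1_inverses A) -> 'M[k]_(d, e) * 'M[k]_(\rank A, d),
    bijective f.
Proof.
move=> dE; set m := mxindex A; set r := \rank A => eE.
have [B [C [ABC Bfull Cfree]]] : exists (B : 'M_(n, r)) (C : 'M_(r, n)),
    [/\ A = B *m C, row_full B & row_free C].
  by exists (col_base A), (row_base A); rewrite mulmx_base col_base_full
    row_base_free.
have [B0 B0B] := row_fullP Bfull; have [R CR] := row_freeP Cfree.
pose D := C *m A ^+ m.
have AmS : A ^+ m.+1 = B *m D by rewrite exprS {1}ABC [in RHS]mulmxA.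
have rkD : \rank D = \rank (A ^+ m).
  by apply/eqP; rewrite eqn_leq mxrankM_maxr -rank_mxindexS AmS mxrankM_maxr.
have [V AV] : exists V, A ^+ m = V *m D.
  by apply/submxP; apply: submx_mull_eq_rank.
(* [R] is corrected by (1 - R C) V, which C kills; as C V D = C A^m = D, the terms R D cancel. *)
have [C0 [CC0 C0D]] : exists C0, C *m C0 = 1%:M /\ C0 *m D = A ^+ m.
  exists (R + (V - R *m (C *m V))); split.
    by rewrite mulmxDr mulmxBr (mulmxA C R) CR mul1mx subrr addr0.
  by rewrite mulmxDl mulmxBl -AV -!mulmxA -AV -/D addrC subrK.
have [K [K' [CK KK' KK]]] : exists (K : 'M[k]_(n, d)) (K' : 'M[k]_(d, n)),
    [/\ C *m K = 0, K' *m K = 1%:M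
      & forall q (N : 'M[k]_(n, q)), C *m N = 0 -> K *m (K' *m N) = N].
  by apply: right_kernel_coordinates; rewrite (eqP Cfree).
have [L [L' [LD LL' LL]]] : exists (L : 'M[k]_(e, r)) (L' : 'M[k]_(r, e)),
    [/\ L *m D = 0, L *m L' = 1%:M
      & forall q (N : 'M[k]_(q, r)), N *m D = 0 -> N *m L' *m L = N].
  by apply: left_kernel_coordinates; rewrite rkD -/r -eE addnK.
have [M [M' [MB MM' MM]]] : exists (M : 'M[k]_(d, n)) (M' : 'M[k]_(n, d)),
    [/\ M *m B = 0, M *m M' = 1%:M
      & forall q (N : 'M[k]_(q, n)), N *m B = 0 -> N *m M' *m M = N].
  by apply: left_kernel_coordinates; rewrite (eqP Bfull).
(* For a GD1 inverse X, X B - C0 is killed by C on the left and D on the right, hence is K Y L; C X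
   - B0 is killed by B on the right, hence is Z M. *)
pose f X := (K' *m (X *m B - C0) *m L', (C *m X - B0) *m M').
pose g (Y : 'M[k]_(d, e) * 'M[k]_(r, d)) :=
  (C0 + K *m Y.1 *m L) *m (B0 + Y.2 *m M).
have gl Y : C *m (C0 + K *m Y *m L) = 1%:M.
  by rewrite mulmxDr CC0 !mulmxA CK !mul0mx addr0.
have gD Y : (C0 + K *m Y *m L) *m D = A ^+ m.
  by rewrite mulmxDl C0D -mulmxA LD mulmx0 addr0.
have gr Z : (B0 + Z *m M) *m B = 1%:M.
  by rewrite mulmxDl B0B -mulmxA MB mulmx0 addr0.
apply: (set_type_bijection (f := f) (g := g)).
- move=> [Y Z]; apply/GD1_inverseP; rewrite /g /=.
  move: (gl Y) (gD Y) (gr Z); move: (C0 + _) (B0 + _) => U T CU UD TB.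
  have ATU : A *m (U *m T) = B *m T by rewrite ABC -mulmxA (mulmxA C) CU mul1mx.
  split; first by rewrite ATU {1}ABC -mulmxA (mulmxA T) TB mul1mx.
    by rewrite -mulmxA ATU -mulmxA (mulmxA T) TB mul1mx.
  by rewrite AmS -mulmxA (mulmxA T) TB mul1mx.
- move=> X /GD1_inverseP[AXA XAX XAm].
  (* B and C cancel from B C X B C = B C. *)
  have CXB : C *m X *m B = 1%:M.
    have /(congr1 (fun N => B0 *m N *m R)) := AXA.
    by rewrite ABC !mulmxA B0B !mul1mx -!mulmxA CR !mulmx1 !mulmxA.
  have CXB0 : C *m (X *m B - C0) = 0 by rewrite mulmxBr mulmxA CXB CC0 subrr.
  have XBD : (X *m B - C0) *m D = 0.
    by rewrite mulmxBl -mulmxA -AmS XAm C0D subrr.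
  have CXB0' : (C *m X - B0) *m B = 0 by rewrite mulmxBl CXB B0B subrr.
  rewrite /g /f /= mulmxA KK // LL // MM // !(addrC _ (_ - _)) !subrK.
  by rewrite mulmxA -(mulmxA X) -ABC.
- move=> [Y Z]; rewrite /f /g /=; congr (_, _).
    rewrite -(mulmxA _ _ B) gr mulmx1 addrC addKr !mulmxA KK' mul1mx.
    by rewrite -mulmxA LL' mulmx1.
  by rewrite mulmxA gl mul1mx addrC addKr -mulmxA MM' mulmx1.
Qed.

End Powers.
End LinearAlgebra.

(** * From pairs of matrices to the products in the statement *)

Lemma matrix_ffun_bijective (k : fieldType) (vT : vectType k) (d e r : nat) :
    d = \dim (fullv : {vspace vT}) ->
  exists h : 'M[k]_(d, e) * 'M[k]_(r, d) ->
             {ffun 'I_e -> vT} * {ffun 'I_d -> 'cV[k]_r},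
    bijective h.
Proof.
rewrite dimvf => ->.
exists (fun Y => ([ffun j => r2v (col j Y.1)^T], [ffun j => col j Y.2])).
exists (fun u : {ffun 'I_e -> vT} * {ffun 'I_(dim vT) -> 'cV_r} =>
  (\matrix_(i, j) v2r (u.1 j) 0 i, \matrix_(i, j) u.2 j i 0)).
  move=> [Y Z]; congr (_, _); apply/matrixP=> i j.
    by rewrite !mxE /= ffunE r2vK !mxE.
  by rewrite !mxE /= ffunE !mxE.
move=> [u v]; congr (_, _); apply/ffunP => j; rewrite !ffunE /=.
  by rewrite -[RHS]v2rK; congr r2v; apply/rowP => i; rewrite !mxE.
by apply/colP => i; rewrite !mxE.
Qed.

Lemma matrix_pair_cV_bijective (k : fieldType) d e r :
  exists h : 'M[k]_(d, e) * 'M[k]_(r, d) -> 'cV[k]_(d * (r + e)), bijective h.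
Proof.
(* The two matrices share the side d, so one transpose lets them be juxtaposed and flattened. *)
exists (fun Y => (mxvec (row_mx Y.2^T Y.1))^T).
exists (fun w => let W := vec_mx w^T in (rsubmx W, (lsubmx W)^T)).
  by move=> [Y Z] /=; rewrite trmxK mxvecK row_mxKr row_mxKl trmxK.
by move=> w /=; rewrite trmxK hsubmxK vec_mxK trmxK.
Qed.

Theorem theorem3p12 (k : fieldType) (n : nat) (A A1 A2 : 'M[k]_n)
    (hA : core_nilpotent_decomposition A A1 A2) :
  (exists f : set_type (GD1_inverses A) ->
              {ffun 'I_(\rank A2) -> subvs_of (nullspace A)} *
              {ffun 'I_(\dim (nullspace A)) -> 'cV[k]_(\rank A)},
     bijective f) /\
  (exists g : {ffun 'I_(\rank A2) -> subvs_of (nullspace A)} *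
              {ffun 'I_(\dim (nullspace A)) -> 'cV[k]_(\rank A)} ->
              'cV[k]_(\dim (nullspace A) * (\rank A + \rank A2)),
     bijective g).
Proof.
have [rkA1 rkA] := rank_core_nilpotent hA.
have rkE : (\rank A2 + \rank (A ^+ mxindex A) = \rank A)%N.
  by rewrite -rkA1 rkA addnC.
have [f bij_f] := GD1_inverses_param (dim_nullspace A) rkE.
have dimE : \dim (nullspace A) = \dim (fullv : {vspace subvs_of (nullspace A)}).
  by rewrite dimvf.
have [h bij_h] := matrix_ffun_bijective (\rank A2) (\rank A) dimE.
have [w bij_w] :=
  matrix_pair_cV_bijective k (\dim (nullspace A)) (\rank A2) (\rank A).
split; first by exists (h \o f); apply: bij_comp.
(* The second bijection goes back through the pairs of matrices. *)
by have [h' hK h'K] := bij_h; exists (w \o h'); apply: bij_comp => //; exists h.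
Qed.
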